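(* Let $q\in\{1,\ldots,5\}$ and let $\{(\mathbf{u}_h^n,p_h^n)\}_{n=q}^N\subset V_h\times Q_h$ be the solution of the fully discrete BDF-$q$ problem: for $n\ge q$, $$(\bar\partial_q\mathbf{u}_h^n,\mathbf{v}_h)+a(\mathbf{u}_h^n,\mathbf{v}_h)+b(p_h^n,\mathbf{v}_h)=(\mathbf{f}^n,\mathbf{v}_h)\quad\forall \mathbf{v}_h\in V_h,\qquad b(q_h,\mathbf{u}_h^n)-j_h(q_h,p_h^n)=0\quad\forall q_h\in Q_h,$$ with initial values $\mathbf{u}_h^i\in V_h$, $i=0,\ldots,q-1$. Then for $0\le N\tau\le T$, $$\|\mathbf{u}_h^N\|_H^2+\|\mathbf{u}_h^\tau\|_{\ell^2(J_q;V)}^2+|p_h^\tau|_{\ell^2(J_q;j_h)}^2\le C\Bigl[\sum_{i=0}^{q-1}\|\mathbf{u}_h^i\|_H^2+\frac{c_P^2}{\nu}\|\mathbf{f}\|_{\ell^2(J_q;H)}^2\Bigr],$$ with a constant $C>0$ independent of $h$, $N$, $\tau$ and the final time $T$.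
   Context: Continuous setting. $\Omega\subset\mathbb{R}^d$, $d\in\{2,3\}$, is a Lipschitz domain, $J=(0,T)$, $\nu>0$ a constant. $H=[L^2(\Omega)]^d$, $V=[H_0^1(\Omega)]^d$, $Q=L_0^2(\Omega)$ (mean-zero $L^2$ functions), $(\cdot,\cdot)$ is the $L^2$ inner product, $a(\mathbf{u},\mathbf{v})=(\nu\nabla\mathbf{u},\nabla\mathbf{v})$, $b(p,\mathbf{v})=-(p,\nabla\cdot\mathbf{v})$, $\|\mathbf{v}\|_H=(\mathbf{v},\mathbf{v})^{1/2}$, $\|\mathbf{v}\|_V=a(\mathbf{v},\mathbf{v})^{1/2}$, $\|q\|_Q=\|\nu^{-1/2}q\|_{L^2}$. $c_P$ is the Poincaré constant: $\|\mathbf{v}\|_H\le c_P\nu^{-1/2}\|\mathbf{v}\|_V$ for $\mathbf{v}\in V$. $\|\cdot\|_m$ is the $H^m(\Omega)$ norm. Spatial discretization. $\{\mathcal{T}_h\}_{0<h\le1}$ is a quasi-uniform family of triangulations of $\Omega$ with mesh size $h$. With $k\ge1$, $l\ge0$, $k-1\le l\le k$, $V_h=[X_h]^d\cap V$ where $X_h$ is the space of continuous functions that are piecewise polynomial of degree $k$ on $\mathcal{T}_h$; $M_h\subset L^2(\Omega)$ is the space of (possibly discontinuous) piecewise polynomials of degree $l$; and $Q_h=M_h\cap Q$ or $Q_h=M_h\cap Q\cap C^0(\overline\Omega)$. The pressure stabilization $j_h:Q_h\times Q_h\to\mathbb{R}$ is bilinear, symmetric, positive semi-definite, with induced semi-norm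 $|q_h|_{j_h}=j_h(q_h,q_h)^{1/2}$, and $|j_h(p_h,q_h)|\le|p_h|_{j_h}|q_h|_{j_h}\le C\|p_h\|_Q\|q_h\|_Q$ ($j_h=0$ is allowed for inf-sup stable pairs). It is assumed that there are quasi-interpolation operators $\mathcal{I}_h^p:Q\to Q_h$, $\mathcal{I}_h^{\mathbf{u}}:V\to V_h$ with, for $s_p=\min\{s,\bar l,l+1\}$ ($\bar l\ge1$ the order of weak consistency of $j_h$) and $r_{\mathbf{u}}=\min\{r,k+1\}$: - $|\mathcal{I}_h^pq|_{j_h}\le C\nu^{-1/2}h^{s_p}\|q\|_{s_p}$ for $q\in Q\cap H^s(\Omega)$, and $\|q-\mathcal{I}_h^pq\|_Q\le C\nu^{-1/2}h^{l+1}\|q\|_{l+1}$ for $q\in Q\cap H^{l+1}(\Omega)$; - $\|\mathbf{v}-\mathcal{I}_h^{\mathbf{u}}\mathbf{v}\|_H+h\nu^{-1/2}\|\mathbf{v}-\mathcal{I}_h^{\mathbf{u}}\mathbf{v}\|_V\le C h^{r_{\mathbf{u}}}\|\mathbf{v}\|_{r_{\mathbf{u}}}$ for $\mathbf{v}\in V\cap[H^r(\Omega)]^d$; - $|b(q_h,\mathbf{v}-\mathcal{I}_h^{\mathbf{u}}\mathbf{v})|\le C|q_h|_{j_h}\bigl(\nu^{1/2}\|h^{-1}(\mathbf{v}-\mathcal{I}_h^{\mathbf{u}}\mathbf{v})\|_H+\|\mathbf{v}-\mathcal{I}_h^{\mathbf{u}}\mathbf{v}\|_V\bigr)$ for $(q_h,\mathbf{v})\in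 Q_h\times V$. These constants are independent of $h$. The assumptions imply (known result) the modified inf-sup condition $\beta\|q_h\|_Q\le\sup_{\mathbf{v}_h\in V_h}\frac{|b(q_h,\mathbf{v}_h)|}{\|\mathbf{v}_h\|_V}+C|q_h|_{j_h}$ for all $q_h\in Q_h$, with $\beta,C>0$ independent of $h$ and $\nu$. Time discretization. $t_n=n\tau$, $n=0,\ldots,N$, $\tau=T/N$. The BDF-$q$ discrete derivative is $\bar\partial_q\mathbf{w}^n=\frac1\tau\sum_{i=0}^q\delta_i\mathbf{w}^{n-i}$ for $n\ge q$, with $\delta_i$ defined by $\sum_{i=0}^q\delta_i\zeta^i=\sum_{m=1}^q\frac1m(1-\zeta)^m$. $\mathbf{f}\in C^0([0,T];[L^2(\Omega)]^d)$ and $\mathbf{f}^n=\mathbf{f}(t_n)$. $J_q=(t_q,T)$, and for a sequence $w^\tau=(w^n)_{n=q}^N$, $\|w^\tau\|_{\ell^2(J_q;\mathcal{H})}^2=\tau\sum_{n=q}^N\|w^n\|_{\mathcal{H}}^2$; likewise $|p^\tau|_{\ell^2(J_q;j_h)}^2=\tau\sum_{n=q}^N|p^n|_{j_h}^2$; $\|\mathbf{f}\|_{\ell^2(J_q;H)}$ uses the values $\mathbf{f}^n$. *)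

(* Defs.v *)
From HB Require Import structures.
From mathcomp Require Import all_boot all_order all_algebra.
From mathcomp Require Import all_classical all_reals all_analysis.
From mathcomp Require Import measurable_realfun.

Set Implicit Arguments.
Unset Strict Implicit.
Unset Printing Implicit Defensive.

Import Order.TTheory GRing.Theory Num.Theory.
Import numFieldNormedType.Exports.

Local Open Scope classical_set_scope.
Local Open Scope ring_scope.

(* R^n is the space of row vectors, with its Borel sets. *)
HB.instance Definition _ (R : realType) (n : nat) :=
  @isMeasurable.Build (sigma_display (@open 'rV[R]_n)) 'rV[R]_n
    <<s @open 'rV[R]_n >> (@sigma_algebra0 _ setT _) (@sigma_algebraC _ _)
    (@sigma_algebra_bigcup _ setT _).

Section lebesgue_rV.
Context {R : realType}.

Lemma open_measurable_rV n (U : set 'rV[R]_n) : open U -> measurable U.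
Proof. by move=> oU; exact: sub_sigma_algebra. Qed.

Lemma measurable_coord n (i : 'I_n) :
  measurable_fun [set: 'rV[R]_n] (fun x : 'rV[R]_n => x ord0 i).
Proof.
apply: (measurability _ (RGenOpens.measurableE R)) => _ [V oV <-].
rewrite setTI; apply: open_measurable_rV.
have {}oV : open V by case: oV => a [b ->]; exact: interval_open.
by apply: open_comp => // x _; exact: coord_continuous.
Qed.

Definition rat_box n (c : 'rV[rat]_n * nat) : set 'rV[R]_n :=
  [set x | forall i, `|ratr (c.1 ord0 i) - x ord0 i| < c.2.+1%:R^-1].

Lemma open_rV_bigcup_box n (U : set 'rV[R]_n) : open U ->
  U = \bigcup_(c in [set c | rat_box c `<=` U]) rat_box c.
Proof.
move=> oU; apply/seteqP; split=> [x Ux|x [c /= cU]]; last exact: cU.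
have /nbhs_ballP[e /= e0 eU] : nbhs x U by exact: open_nbhs_nbhs.
have e20 : 0 < e / 2 by rewrite divr_gt0.
have [k _ /(_ k (leqnn k)) /= ke] := near_infty_natSinv_lt (PosNum e20).
have k0 : 0 < k.+1%:R^-1 :> R by rewrite invr_gt0.
have qP i : exists q : rat, `|ratr q - x ord0 i| < k.+1%:R^-1.
  have /rat_in_itvoo[q] : x ord0 i - k.+1%:R^-1 < x ord0 i + k.+1%:R^-1.
    by rewrite ltrBlDr -addrA ltrDl addr_gt0.
  by rewrite in_itv/= -ltr_distl; exists q.
pose c : 'rV[rat]_n * nat := (\row_i projT1 (cid (qP i)), k).
exists c => /=; last by move=> i; rewrite mxE; case: cid.
move=> y cy; apply: eU; split => // i j; rewrite /ball/= ord1.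
have := cy j; rewrite mxE; case: cid => q /= qx yq.
rewrite (splitr e) -[_ - _](subrKA (ratr q)) (le_lt_trans (ler_normD _ _))//.
by rewrite ltrD// ?(lt_trans _ ke)// distrC.
Qed.

Definition rV_cons n (p : R * 'rV[R]_n) : 'rV[R]_n.+1 :=
  row_mx (const_mx p.1 : 'rV_1) p.2.

Lemma rV_cons0 n (p : R * 'rV[R]_n) : rV_cons p ord0 ord0 = p.1.
Proof.
rewrite /rV_cons.
have e : ord0 = lshift n ord0 :> 'I_(1 + n) by apply: val_inj.
rewrite [X in fun_of_matrix _ _ X]e.
by rewrite (row_mxEl (const_mx p.1 : 'rV_1) p.2 ord0 ord0) mxE.
Qed.

Lemma rV_consS n (p : R * 'rV[R]_n) j :
  rV_cons p ord0 (lift ord0 j) = p.2 ord0 j.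
Proof.
rewrite /rV_cons.
have e : lift ord0 j = rshift 1 j :> 'I_(1 + n) by apply: val_inj.
by have := row_mxEr (const_mx p.1 : 'rV_1) p.2 ord0 j; rewrite -e.
Qed.

Lemma measurable_rV_cons n : measurable_fun setT (@rV_cons n).
Proof.
have mc (i : 'I_n.+1) : measurable_fun setT (fun p => @rV_cons n p ord0 i).
  case: (unliftP ord0 i) => [j|] ->.
    under eq_fun do rewrite rV_consS.
    apply: (@measurableT_comp _ _ _ _ _ _ (fun x : 'rV[R]_n => x ord0 j)) => //.
    exact: measurable_coord.
  by under eq_fun do rewrite rV_cons0; exact: measurable_fst.
apply: (@measurability _ _ _ _ _ _ (@open 'rV[R]_n.+1)) => // _ [U oU <-].
rewrite setTI (open_rV_bigcup_box oU) preimage_bigcup.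
have mbox c : measurable (@rV_cons n @^-1` rat_box c).
  rewrite (_ : _ @^-1` _ = \bigcap_(i in setT)
      [set p | `|ratr (c.1 ord0 i) - rV_cons p ord0 i| < c.2.+1%:R^-1]).
    apply: fin_bigcap_measurable => // i _.
    have oB : open [set y : R | `|ratr (c.1 ord0 i) - y| < c.2.+1%:R^-1].
      exact: (@ball_open _ R).
    by have := mc i measurableT _ (open_measurable oB); rewrite setTI.
  by apply/seteqP; split=> p /= h i; [move=> _; exact: h|exact: (h i I)].
rewrite (_ : \bigcup_(_ in _) _ = \bigcup_k
    (if unpickle k is Some c then
       if `[< rat_box c `<=` U >] then @rV_cons n @^-1` rat_box c else set0
     else set0)).
  apply: bigcupT_measurable => k; case: unpickle => // c.
  by case: ifPn => // _; exact: mbox.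
apply/seteqP; split=> [p [c cU cp]|p [k _]].
  by exists (pickle c) => //; rewrite pickleK; case: asboolP.
by case: unpickle => // c; case: asboolP => // cU cp; exists c.
Qed.

(* Image of lebesgue_measure \x^ m under rV_cons; \x^ is the product measure
   that needs sigma-finiteness of its first factor only. *)
Definition lebesgue_rV_step n (m : {measure set 'rV[R]_n -> \bar R}) :
    set 'rV[R]_n.+1 -> \bar R :=
  pushforward (lebesgue_measure \x^ m)%E (@rV_cons n).

HB.instance Definition _ n (m : {measure set 'rV[R]_n -> \bar R}) :=
  Measure.copy (lebesgue_rV_step m)
    (measure_function_pushforward__canonical__measure_function_Measure
      (lebesgue_measure \x^ m)%E (@measurable_rV_cons n)).

Fixpoint lebesgue_rV n : {measure set 'rV[R]_n -> \bar R} :=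
  if n is m.+1 then lebesgue_rV_step (lebesgue_rV m)
  else \d_(0 : 'rV[R]_0).


Lemma measurable_box n (a b : 'rV[R]_n) :
  measurable [set x : 'rV[R]_n | forall i, a ord0 i < x ord0 i < b ord0 i].
Proof.
have -> : [set x : 'rV[R]_n | forall i, a ord0 i < x ord0 i < b ord0 i] =
    \bigcap_(i in [set: 'I_n])
      ((fun x : 'rV[R]_n => x ord0 i) @^-1` `]a ord0 i, b ord0 i[%classic).
  apply/seteqP; split=> x /=; first by move=> h i _; rewrite /= in_itv/=.
  by move=> h i; have := h i I; rewrite /= in_itv.
apply: fin_bigcap_measurable => [|i _]; first exact: finite_finset.
have := measurable_coord i measurableT
  (measurable_itv `]a ord0 i, b ord0 i[); by rewrite setTI.
Qed.

Lemma lebesgue_rV_box n (a b : 'rV[R]_n) : (forall i, a ord0 i <= b ord0 i) ->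
  lebesgue_rV n [set x : 'rV[R]_n | forall i, a ord0 i < x ord0 i < b ord0 i] =
  (\prod_i (b ord0 i - a ord0 i))%:E.
Proof.
elim: n a b => [|n IH] a b ab.
  by rewrite big_ord0 /= diracE mem_set//= => -[].
pose tl (c : 'rV[R]_n.+1) : 'rV[R]_n := \row_j c ord0 (lift ord0 j).
rewrite /= /lebesgue_rV_step /pushforward.
transitivity ((lebesgue_measure \x^ lebesgue_rV n)%E
    (`]a ord0 ord0, b ord0 ord0[%classic `*`
     [set x : 'rV[R]_n | forall i, tl a ord0 i < x ord0 i < tl b ord0 i])).
  congr (product_measure2 _ _ _); apply/seteqP; split=> p /=.
    move=> h; split; first by have := h ord0; rewrite rV_cons0 in_itv.
    by move=> i; have := h (lift ord0 i); rewrite rV_consS !mxE.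
  move=> [+ h] i; rewrite in_itv/=.
  case: (unliftP ord0 i) => [j|] ->; last by rewrite rV_cons0.
  by rewrite rV_consS; have := h j; rewrite !mxE.
rewrite product_measure2E//; last exact: measurable_box.
rewrite IH => [|i]; last by rewrite !mxE.
rewrite [X in (X * _)%E](@lebesgue_measure_itv R `]a ord0 ord0, b ord0 ord0[).
rewrite /= lte_fin big_ord_recl.
under eq_bigr do rewrite !mxE.
have := ab ord0; rewrite le_eqVlt => /predU1P[->|->]; last by rewrite EFinM.
by rewrite ltxx subrr mul0r mul0e.
Qed.

End lebesgue_rV.

Section function_spaces.
Context {R : realType} {d : nat} (Omega : set 'rV[R]_d).
Implicit Types (f g phi : 'rV[R]_d -> R) (s : seq 'I_d).

Local Notation mu := (@lebesgue_rV R d).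

Definition dotv (x y : 'rV[R]_d) : R := \sum_i x ord0 i * y ord0 i.

Definition enorm (x : 'rV[R]_d) : R := Num.sqrt (dotv x x).

(* Near each boundary point, Omega lies below the graph of a Lipschitz
   function over the hyperplane orthogonal to a unit vector e; gamma is only
   evaluated on that hyperplane. *)
Definition lipschitz_domain : Prop :=
  [/\ Omega !=set0, open Omega, connected Omega, bounded_set Omega &
    forall x : 'rV[R]_d, (closure Omega `\` Omega) x ->
      exists (e : 'rV[R]_d) (r L : R) (gamma : 'rV[R]_d -> R),
        [/\ dotv e e = 1, 0 < r, L.-lipschitz gamma &
          forall y : 'rV[R]_d, enorm (y - x) < r ->
            Omega y <-> dotv y e < gamma (y - dotv y e *: e)]].

(* The elements of L^2(Omega) are represented by functions on R^d; the values
   off Omega never matter. *)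
Definition L2 f : Prop :=
  measurable_fun Omega f /\ mu.-integrable Omega (EFin \o (fun x => f x ^+ 2)).

Definition ip f g : R := \int[mu]_(x in Omega) (f x * g x).

Definition L2norm f : R := Num.sqrt (ip f f).

Definition L2mx m n (F : 'rV[R]_d -> 'M[R]_(m, n)) : Prop :=
  forall i j, L2 (fun x => F x i j).

Definition ipmx m n (F G : 'rV[R]_d -> 'M[R]_(m, n)) : R :=
  \sum_i \sum_j ip (fun x => F x i j) (fun x => G x i j).

Definition normmx m n (F : 'rV[R]_d -> 'M[R]_(m, n)) : R :=
  Num.sqrt (ipmx F F).

Definition partial (i : 'I_d) f : 'rV[R]_d -> R :=
  fun x => 'D_(delta_mx ord0 i) f x.

Definition partials s f : 'rV[R]_d -> R := foldr partial f s.

Definition smooth f : Prop := forall s,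
  continuous (partials s f) /\
  forall i x, derivable (partials s f) x (delta_mx ord0 i).

Definition test_function phi : Prop :=
  smooth phi /\ exists K : set 'rV[R]_d,
    [/\ compact K, K `<=` Omega & forall x, ~ K x -> phi x = 0].

Definition weak_partials s f g : Prop := forall phi, test_function phi ->
  ip f (partials s phi) = (- 1) ^+ size s * ip g phi.

(* The derivatives encoded by a multi-index of order at most m. *)
Definition mindex m (alpha : {ffun 'I_d -> 'I_m.+1}) : seq 'I_d :=
  flatten [seq nseq (alpha i) i | i <- enum 'I_d].

Definition sobolev m f : Prop := L2 f /\
  forall alpha : {ffun 'I_d -> 'I_m.+1}, (\sum_i alpha i <= m)%N ->
    exists g, L2 g /\ weak_partials (mindex alpha) f g.

Definition weak_derivative s f : 'rV[R]_d -> R :=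
  xget 0 [set g | L2 g /\ weak_partials s f g].

Definition sobolev_norm m f : R :=
  Num.sqrt (\sum_(alpha : {ffun 'I_d -> 'I_m.+1} | (\sum_i alpha i <= m)%N)
              L2norm (weak_derivative (mindex alpha) f) ^+ 2).

Definition sobolev_rV m (v : 'rV[R]_d -> 'rV[R]_d) : Prop :=
  forall j, sobolev m (fun x => v x ord0 j).

Definition sobolev_norm_rV m (v : 'rV[R]_d -> 'rV[R]_d) : R :=
  Num.sqrt (\sum_j sobolev_norm m (fun x => v x ord0 j) ^+ 2).

Definition Lzero2 f : Prop := L2 f /\ \int[mu]_(x in Omega) f x = 0.

End function_spaces.

(* A weakly differentiable vector field is represented by the pair (v, G) of
   the field and its weak gradient, G x i j being the i-th partial derivative
   of the j-th component; v determines G up to a null set. *)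
Definition vfield (R : realType) (d : nat) : Type :=
  (('rV[R]_d -> 'rV[R]_d) * ('rV[R]_d -> 'M[R]_d))%type.
HB.instance Definition _ (R : realType) (d : nat) :=
  GRing.Lmodule.copy (vfield R d)
    (('rV[R]_d -> 'rV[R]_d) * ('rV[R]_d -> 'M[R]_d))%type.

Section stokes_forms.
Context {R : realType} {d : nat} (Omega : set 'rV[R]_d) (nu : R).
Implicit Types (v w : vfield R d) (q : 'rV[R]_d -> R).

Definition gradient (phi : 'rV[R]_d -> 'rV[R]_d) : 'rV[R]_d -> 'M[R]_d :=
  fun x => \matrix_(i, j) partial i (fun y => phi y ord0 j) x.

(* [H^1_0(Omega)]^d as the closure of the test fields in the H^1 norm; this
   makes v.2 the weak gradient of v.1. *)
Definition H10 v : Prop :=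
  [/\ L2mx Omega v.1, L2mx Omega v.2 &
    forall e : R, 0 < e -> exists phi : 'rV[R]_d -> 'rV[R]_d,
      [/\ forall j, test_function Omega (fun x => phi x ord0 j),
          normmx Omega (v.1 - phi) < e &
          normmx Omega (v.2 - gradient phi) < e]].

Definition a_form v w : R := ipmx Omega (nu *: v.2) w.2.

Definition b_form q v : R := - ip Omega q (fun x => \tr (v.2 x)).

Definition normH (v : 'rV[R]_d -> 'rV[R]_d) : R := normmx Omega v.

Definition normV v : R := Num.sqrt (a_form v v).

Definition normQ q : R := L2norm Omega ((Num.sqrt nu)^-1 *: q).

(* nu^(-1/2) |v|_V is the L^2 norm of the gradient. *)
Definition poincare_constant (c : R) : Prop :=
  0 < c /\ forall v, H10 v -> normH v.1 <= c * (Num.sqrt nu)^-1 * normV v.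

(* f belongs to C^0([0, T]; [L^2(Omega)]^d). *)
Definition continuous_L2 (T : R) (f : R -> 'rV[R]_d -> 'rV[R]_d) : Prop :=
  forall t : R, 0 <= t <= T -> L2mx Omega (f t) /\
    normH (f s - f t) @[s --> within `[0, T] (nbhs t)] --> (0 : R).

End stokes_forms.

Section finite_elements.
Context {R : realType} {d : nat} (Omega : set 'rV[R]_d).

(* The face of the simplex with vertices the rows of A that is spanned by the
   vertices in S. *)
Definition face (A : 'M[R]_(d.+1, d)) (S : pred 'I_d.+1) : set 'rV[R]_d :=
  [set x | exists w : 'rV[R]_d.+1,
    [/\ x = w *m A, forall i, 0 <= w ord0 i, \sum_i w ord0 i = 1 &
        forall i, ~~ S i -> w ord0 i = 0]].

Definition simplex (A : 'M[R]_(d.+1, d)) : set 'rV[R]_d := face A xpredT.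

Definition affinely_free (A : 'M[R]_(d.+1, d)) : bool :=
  row_free (row_mx A (const_mx 1 : 'cV[R]_d.+1)).

Definition triangulation (Th : seq 'M[R]_(d.+1, d)) : Prop :=
  [/\ {in Th, forall K, affinely_free K},
      closure Omega = \bigcup_(K in [set` Th]) simplex K &
      {in Th &, forall K K', exists S S' : pred 'I_d.+1,
        simplex K `&` simplex K' = face K S /\ face K S = face K' S'}].

(* h bounds the diameters, and every simplex contains a ball of radius rho h:
   a quasi-uniform family indexed by all h in ]0, 1] cannot have largest
   diameter exactly h when Omega is small. *)
Definition quasi_uniform (Th : R -> seq 'M[R]_(d.+1, d)) : Prop :=
  (forall h : R, 0 < h <= 1 -> triangulation (Th h) /\
    {in Th h, forall K x y, simplex K x -> simplex K y -> enorm (x - y) <= h})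
  /\ exists rho : R, 0 < rho /\ forall h : R, 0 < h <= 1 ->
    {in Th h, forall K, exists x0 : 'rV[R]_d, forall x : 'rV[R]_d,
       enorm (x - x0) <= rho * h -> simplex K x}.

Definition polynomial_on (k : nat) (D : set 'rV[R]_d) (f : 'rV[R]_d -> R) :=
  exists c : {ffun 'I_d -> 'I_k.+1} -> R, forall x, D x ->
    f x = \sum_(alpha : {ffun 'I_d -> 'I_k.+1} | (\sum_i alpha i <= k)%N)
            c alpha * \prod_i x ord0 i ^+ alpha i.

Definition Xspace k (Th : seq 'M[R]_(d.+1, d)) (v : 'rV[R]_d -> R) : Prop :=
  {within closure Omega, continuous v} /\
  {in Th, forall K, polynomial_on k (simplex K) v}.

Definition Vspace k Th (v : vfield R d) : Prop :=
  H10 Omega v /\ forall j, Xspace k Th (fun x => v.1 x ord0 j).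

Definition Mspace l (Th : seq 'M[R]_(d.+1, d)) (q : 'rV[R]_d -> R) : Prop :=
  L2 Omega q /\ {in Th, forall K, polynomial_on l (interior (simplex K)) q}.

(* cont selects the variant of Q_h with continuous pressures. *)
Definition Qspace (cont : bool) l Th (q : 'rV[R]_d -> R) : Prop :=
  [/\ Mspace l Th q, Lzero2 Omega q &
      cont -> {within closure Omega, continuous q}].

End finite_elements.

Section discretization.
Context {R : realType} {d : nat} (Omega : set 'rV[R]_d) (nu : R).
Local Notation pfun := ('rV[R]_d -> R).
Local Notation ufun := ('rV[R]_d -> 'rV[R]_d).

Section stabilization.
Variables (Vh : R -> vfield R d -> Prop) (Qh : R -> pfun -> Prop).
Variable jh : R -> pfun -> pfun -> R.

Definition normj h (q : pfun) : R := Num.sqrt (jh h q q).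

Definition pressure_stabilization : Prop :=
  (forall h : R, 0 < h <= 1 ->
    [/\ forall (c : R) (p p' q : pfun), Qh h p -> Qh h p' -> Qh h q ->
          jh h (c *: p + p') q = c * jh h p q + jh h p' q,
        forall p q : pfun, Qh h p -> Qh h q -> jh h p q = jh h q p &
        forall q, Qh h q -> 0 <= jh h q q])
  /\ exists C : R, 0 < C /\ forall h : R, 0 < h <= 1 ->
    forall p q : pfun, Qh h p -> Qh h q ->
      `|jh h p q| <= normj h p * normj h q /\
      normj h p * normj h q <= C * normQ Omega nu p * normQ Omega nu q.

(* k and l are the degrees of V_h and Q_h, lbar is the order of weak
   consistency of j_h. *)
Definition interpolation (k l lbar : nat)
    (Ip : R -> pfun -> pfun) (Iu : R -> vfield R d -> vfield R d) : Prop :=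
  [/\ forall h : R, 0 < h <= 1 ->
        (forall q, Lzero2 Omega q -> Qh h (Ip h q)) /\
        (forall v, H10 Omega v -> Vh h (Iu h v)),
      forall s, (0 < s)%N -> exists C : R, 0 < C /\
        forall h : R, 0 < h <= 1 -> forall q, Lzero2 Omega q -> sobolev Omega s q ->
          normj h (Ip h q) <= C * (Num.sqrt nu)^-1
            * h ^+ minn s (minn lbar l.+1) * sobolev_norm Omega s q,
      exists C : R, 0 < C /\
        forall h : R, 0 < h <= 1 -> forall q : pfun, Lzero2 Omega q ->
          sobolev Omega l.+1 q ->
          normQ Omega nu (q - Ip h q) <= C * (Num.sqrt nu)^-1
            * h ^+ l.+1 * sobolev_norm Omega l.+1 q,
      forall r, (0 < r)%N -> exists C : R, 0 < C /\
        forall h : R, 0 < h <= 1 -> forall v : vfield R d, H10 Omega v ->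
          sobolev_rV Omega r v.1 ->
          normH Omega (v - Iu h v).1
            + h * (Num.sqrt nu)^-1 * normV Omega nu (v - Iu h v) <=
          C * h ^+ minn r k.+1 * sobolev_norm_rV Omega (minn r k.+1) v.1 &
      exists C : R, 0 < C /\
        forall h : R, 0 < h <= 1 -> forall (q : pfun) (v : vfield R d),
          Qh h q -> H10 Omega v ->
          `|b_form Omega q (v - Iu h v)| <= C * normj h q *
            (Num.sqrt nu * normH Omega (h^-1 *: (v - Iu h v).1)
             + normV Omega nu (v - Iu h v))].

End stabilization.

Definition bdf_poly (q : nat) : {poly R} :=
  \sum_(1 <= m < q.+1) m%:R^-1 *: (1 - 'X) ^+ m.

Definition bdf (q : nat) (tau : R) (w : nat -> ufun) (n : nat) : ufun :=
  tau^-1 *: \sum_(i < q.+1) (bdf_poly q)`_i *: w (n - i)%N.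

Definition bdf_solution (Vh : vfield R d -> Prop) (Qh : pfun -> Prop)
    (j : pfun -> pfun -> R) (q N : nat) (tau : R) (f : R -> ufun)
    (u : nat -> vfield R d) (p : nat -> pfun) : Prop :=
  (forall i, (i < q)%N -> Vh (u i)) /\
  forall n, (q <= n <= N)%N ->
    [/\ Vh (u n), Qh (p n),
        forall v, Vh v ->
          ipmx Omega (bdf q tau (fun m => (u m).1) n) v.1
            + a_form Omega nu (u n) v + b_form Omega (p n) v
          = ipmx Omega (f (n%:R * tau)) v.1 &
        forall r, Qh r -> b_form Omega r (u n) - j r (p n) = 0].

Definition l2norm (W : Type) (norm : W -> R) (q N : nat) (tau : R)
    (w : nat -> W) : R :=
  Num.sqrt (tau * \sum_(q <= n < N.+1) norm (w n) ^+ 2).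

End discretization.

(* Main.v *)
Require Import Defs.
From HB Require Import structures.
From mathcomp Require Import all_boot all_order all_algebra.
From mathcomp Require Import all_classical all_reals all_analysis.
From mathcomp Require Import measurable_realfun ring lra.
Import Order.TTheory GRing.Theory Num.Theory.
Import numFieldNormedType.Exports.
Local Open Scope classical_set_scope.
Local Open Scope ring_scope.

(* Testing the equation at level n with u^n - eta u^(n-1) makes BDF-q G-stable
   for q <= 5 (Nevanlinna-Odeh multipliers); eta = 9/10 serves all five orders.
   The incompressibility equations at levels n and n-1 turn the pressure terms
   into j(p^n, p^n) - eta j(p^n, p^(n-1)), and Young's inequality absorbs the
   products of consecutive levels because eta < 1. Everything depends only on
   the Gram arrays (u^i, u^j), a(u^i, u^j) and j(p^i, p^j), so the estimate is
   one about real arrays. *)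

Set Implicit Arguments.
Unset Strict Implicit.
Unset Printing Implicit Defensive.

(** * Positive semidefinite real arrays and Young's inequality *)

Section psd_arrays.
Context {R : realType}.
Implicit Types (g : nat -> nat -> R) (c : nat -> R) (k : nat -> nat).

(** The selection [k] may repeat indices, so the property survives every reindexing, including
    reversed windows [n - i] with truncated subtraction. *)
Definition psd g := (forall i j, g i j = g j i) /\
  forall n c k, 0 <= \sum_(0 <= i < n) \sum_(0 <= j < n) c i * c j * g (k i) (k j).

Lemma psd_reindex g k : psd g -> psd (fun i j => g (k i) (k j)).
Proof.
by move=> [gC g0]; split=> [i j|n c k']; [exact: gC|exact: (g0 n c (k \o k'))].
Qed.

Lemma psd_seq g (c : seq R) : psd g ->
  0 <= \sum_(0 <= i < size c) \sum_(0 <= j < size c) c`_i * c`_j * g i j.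
Proof. by case=> _ /(_ (size c) (nth 0 c) id). Qed.

Lemma psd_pair g (a b : R) i j : psd g ->
  0 <= a ^+ 2 * g i i + 2 * a * b * g i j + b ^+ 2 * g j j.
Proof.
move=> [gC /(_ 2%N (nth 0 [:: a; b]) (nth 0%N [:: i; j]))].
by rewrite unlock /= (gC j i); lra.
Qed.

Lemma psd_diag g i : psd g -> 0 <= g i i.
Proof. by move=> /(psd_pair 1 0 i i); lra. Qed.

Lemma psd_young g i j : psd g -> `|g i j| <= (g i i + g j j) / 2.
Proof.
move=> pg; have := psd_pair 1 1 i j pg; have := psd_pair 1 (-1) i j pg.
by rewrite ler_norml => ? ?; apply/andP; split; lra.
Qed.

(** The quadratic form at the vector (1, -s e), divided by e, bounds 2 s [g i j] for s = 1 and s =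
    -1. *)
Lemma psd_young_weight (g : nat -> nat -> R) (e : R) i j : psd g -> 0 < e ->
  2 * `|g i j| <= g i i / e + e * g j j.
Proof.
move=> pg e0; have h s : s ^+ 2 = 1 -> 2 * s * g i j <= g i i / e + e * g j j.
  move=> s1; have := psd_pair 1 (- s * e) i j pg.
  rewrite exprMn sqrrN s1 => gs; rewrite -subr_ge0.
  rewrite [leRHS](_ : _ = e^-1 * (1 ^+ 2 * g i i + 2 * 1 * (- s * e) * g i j
    + 1 * e ^+ 2 * g j j)); last by field; rewrite gt_eqF.
  by rewrite mulr_ge0// invr_ge0 ltW.
have h1 := h 1 (expr1n _ _).
have h2 := h (-1); rewrite sqrrN expr1n in h2; have {}h2 := h2 erefl.
by case: (ger0P (g i j)) => _; lra.
Qed.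

Lemma term_le_sum (F : nat -> R) n i : (forall j, 0 <= F j) -> (i < n)%N ->
  F i <= \sum_(0 <= j < n) F j.
Proof.
move=> F0 ni; rewrite (bigD1_seq i) ?mem_index_iota ?iota_uniq//= lerDl.
by apply: sumr_ge0 => j _; exact: F0.
Qed.

(** Weaker than [psd]: for the stabilization it follows from nonnegativity and Cauchy-Schwarz, with
    no expansion of sums. *)
Definition diag_dominated (g : nat -> nat -> R) := forall i j,
  0 <= g i i /\ `|g i j| <= (g i i + g j j) / 2.

Definition qform n (M : seq (seq R)) g :=
  \sum_(0 <= i < n) \sum_(0 <= j < n) (nth [::] M i)`_j * g i j.

(** Each [g i j] in the window is at most the trace in absolute value, so [L] adds up the absolute
    entries of [M]; the extra 1 keeps it positive. *)
Lemma qform_le n M : exists2 L : R, 0 < L & forall g, psd g ->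
  qform n M g <= L * \sum_(0 <= i < n) g i i.
Proof.
pose m i j := `|(nth [::] M i)`_j|.
exists (1 + \sum_(0 <= i < n) \sum_(0 <= j < n) m i j).
  rewrite ltr_pwDl// sumr_ge0// => i _; rewrite sumr_ge0// => j _.
  exact: normr_ge0.
move=> g pg; set S := \sum_(0 <= i < n) g i i.
have S0 : 0 <= S by apply: sumr_ge0 => i _; exact: psd_diag.
have gS i : (i < n)%N -> g i i <= S.
  by apply: term_le_sum => j; exact: psd_diag.
rewrite mulrDl mul1r mulr_suml -[leLHS]add0r lerD//.
apply: ler_sum_nat => i /andP[_ ni]; rewrite mulr_suml.
apply: ler_sum_nat => j /andP[_ nj].
rewrite (le_trans (ler_norm _))// normrM ler_wpM2l//.
rewrite (le_trans (psd_young i j pg))//.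
by have := gS i ni; have := gS j nj; lra.
Qed.

End psd_arrays.

(** * G-stability of BDF-1 to BDF-5 *)

Section bdf_energy.
Context {R : realType}.
Local Notation bdf_coef q := (bdf_poly (R := R) q).

Lemma coef_bdf_poly q i : (bdf_coef q)`_i =
  \sum_(1 <= m < q.+1) m%:R^-1 * ((-1) ^+ i *+ 'C(m, i)).
Proof.
rewrite /bdf_poly coef_sum; apply: eq_bigr => m _; rewrite coefZ.
have -> : (1 - 'X) ^+ m = \poly_(j < m.+1) ((-1) ^+ j *+ 'C(m, j)) :> {poly R}.
  rewrite exprBn poly_def; apply: eq_bigr => j _.
  rewrite expr1n mulr1 -scalerMnl -mul_polyC; congr (_ * _ *+ _).
  by rewrite rmorphXn /= rmorphN1.
by rewrite coef_poly ltnS; case: leqP => // /bin_small->.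
Qed.

(* Dahlquist's G-stability of BDF-q tested with u^n - 9/10 u^(n-1), where g is
   the Gram array of u^n, u^(n-1), ... *)
Definition G_stable q (G : seq (seq R)) := forall g, psd g ->
  g 0%N 0%N / 1000 <= qform q G g /\
  qform q G g - qform q G (fun i j => g i.+1 j.+1) <=
    \sum_(0 <= i < q.+1) (bdf_coef q)`_i * (g i 0%N - 9 / 10 * g i 1%N).

(* The energy matrices come from spectral factorization of the trigonometric
   polynomial Re (delta(z) (1 - 9/10 / z)), rounded to rationals under the
   constraint that the dissipated form vanishes on constant sequences.
   Nonnegativity is certified by squares: the rounded rows of an LDL^T
   decomposition, then short vectors absorbing the diagonally dominant
   remainder; lra finds the weights. *)
Definition bdf1_energy : seq (seq R) := [seq [seq x / 20 | x <- r] | r <-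
  [:: [:: 1]]].

Lemma bdf1_coef i : (i <= 1)%N -> (bdf_coef 1)`_i =
  [:: 1; -1]`_i.
Proof.
case: i => [|[|//]] _;
  rewrite coef_bdf_poly unlock /= !(binS, bin0, bin0n) /= ?(addnS, addn0); lra.
Qed.

Lemma bdf1_G_stable : G_stable 1 bdf1_energy.
Proof.
move=> g pg; have gC := pg.1; rewrite /qform /bdf1_energy; split.
  move: (psd_diag 0 pg).
  by rewrite unlock /=; lra.
(* The dissipated form is exactly 19/20 times the square of u^n - u^(n-1). *)
move: (psd_pair 1 (-1) 0 1 pg).
rewrite unlock /= !bdf1_coef//= !(gC 1%N 0%N).
by lra.
Qed.

Definition bdf2_energy : seq (seq R) := [seq [seq x / 40 | x <- r] | r <-
  [:: [:: 11; -8];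
     [:: -8; 7]]].

Lemma bdf2_coef i : (i <= 2)%N -> (bdf_coef 2)`_i =
  [:: 3 / 2; -2; 1 / 2]`_i.
Proof.
case: i => [|[|[|//]]] _;
  rewrite coef_bdf_poly unlock /= !(binS, bin0, bin0n) /= ?(addnS, addn0); lra.
Qed.

Lemma bdf2_G_stable : G_stable 2 bdf2_energy.
Proof.
move=> g pg; have gC := pg.1; rewrite /qform /bdf2_energy; split.
  move: (psd_seq [:: 4; -3] pg) (psd_diag 1 pg) (psd_diag 0 pg)
    (psd_pair 1 1 0 1 pg).
  rewrite unlock /= !(gC 1%N 0%N).
  by lra.
(* Constant sequences dissipate nothing, so here and for the higher orders each vector certifying
   the dissipation has entries of sum zero. *)
move: (psd_seq [:: 4; -5; 1] pg) (psd_pair 1 (-1) 1 2 pg)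
  (psd_pair 1 (-1) 0 1 pg) (psd_pair 1 (-1) 0 2 pg).
rewrite unlock /= !bdf2_coef//= !(gC 1%N 0%N, gC 2%N 0%N, gC 2%N 1%N).
by lra.
Qed.

Definition bdf3_energy : seq (seq R) := [seq [seq x / 120 | x <- r] | r <-
  [:: [:: 59; -60; 12];
     [:: -60; 77; -24];
     [:: 12; -24; 14]]].

Lemma bdf3_coef i : (i <= 3)%N -> (bdf_coef 3)`_i =
  [:: 11 / 6; -3; 3 / 2; -1 / 3]`_i.
Proof.
case: i => [|[|[|[|//]]]] _;
  rewrite coef_bdf_poly unlock /= !(binS, bin0, bin0n) /= ?(addnS, addn0); lra.
Qed.

Lemma bdf3_G_stable : G_stable 3 bdf3_energy.
Proof.
move=> g pg; have gC := pg.1; rewrite /qform /bdf3_energy; split.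
  move: (psd_seq [:: 30; -31; 6] pg) (psd_seq [:: 0; 6; -5] pg)
    (psd_diag 2 pg) (psd_diag 0 pg) (psd_diag 1 pg) (psd_pair 1 (-1) 0 1 pg)
    (psd_pair 1 1 0 2 pg) (psd_pair 1 (-1) 1 2 pg).
  rewrite unlock /= !(gC 1%N 0%N, gC 2%N 0%N, gC 2%N 1%N).
  by lra.
move: (psd_seq [:: 8; -11; 4; -1] pg) (psd_seq [:: 0; 8; -13; 5] pg)
  (psd_pair 1 (-1) 2 3 pg) (psd_pair 1 (-1) 0 1 pg) (psd_pair 1 (-1) 1 2 pg)
  (psd_pair 1 (-1) 0 2 pg) (psd_seq [:: 1; -1; 1; -1] pg)
  (psd_pair 1 (-1) 1 3 pg).
rewrite unlock /= !bdf3_coef//=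
  !(gC 1%N 0%N, gC 2%N 0%N, gC 2%N 1%N, gC 3%N 0%N, gC 3%N 1%N,
  gC 3%N 2%N).
by lra.
Qed.

Definition bdf4_energy : seq (seq R) := [seq [seq x / 240 | x <- r] | r <-
  [:: [:: 289; -360; 120; -24];
     [:: -360; 529; -240; 48];
     [:: 120; -240; 181; -48];
     [:: -24; 48; -48; 21]]].

Lemma bdf4_coef i : (i <= 4)%N -> (bdf_coef 4)`_i =
  [:: 25 / 12; -4; 3; -4 / 3; 1 / 4]`_i.
Proof.
case: i => [|[|[|[|[|//]]]]] _;
  rewrite coef_bdf_poly unlock /= !(binS, bin0, bin0n) /= ?(addnS, addn0); lra.
Qed.

Lemma bdf4_G_stable : G_stable 4 bdf4_energy.
Proof.
move=> g pg; have gC := pg.1; rewrite /qform /bdf4_energy; split.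
  move: (psd_seq [:: 12; -15; 5; -1] pg) (psd_seq [:: 0; 12; -14; 3] pg)
    (psd_seq [:: 0; 0; 3; -2] pg) (psd_diag 3 pg) (psd_diag 0 pg)
    (psd_diag 1 pg) (psd_diag 2 pg) (psd_pair 1 (-1) 0 1 pg)
    (psd_pair 1 1 0 2 pg) (psd_pair 1 (-1) 1 2 pg) (psd_pair 1 (-1) 0 3 pg)
    (psd_pair 1 (-1) 1 3 pg) (psd_pair 1 1 2 3 pg).
  rewrite unlock /= !(gC 1%N 0%N, gC 2%N 0%N, gC 2%N 1%N, gC 3%N 0%N, gC 3%N 1%N,
    gC 3%N 2%N).
  by lra.
move: (psd_seq [:: 20; -33; 23; -13; 3] pg)
  (psd_seq [:: 0; 20; -16; -3; -1] pg) (psd_seq [:: 0; 0; 20; -31; 11] pg)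
  (psd_pair 1 (-1) 3 4 pg) (psd_pair 1 (-1) 0 1 pg) (psd_pair 1 (-1) 1 2 pg)
  (psd_pair 1 (-1) 2 3 pg) (psd_seq [:: 1; -2; 1; 0; 0] pg)
  (psd_seq [:: 1; -1; 1; -1; 0] pg) (psd_seq [:: 0; 1; -2; 1; 0] pg)
  (psd_seq [:: 1; -1; 0; 1; -1] pg) (psd_seq [:: 0; 1; -1; -1; 1] pg)
  (psd_seq [:: 0; 0; 1; -2; 1] pg).
rewrite unlock /= !bdf4_coef//=
  !(gC 1%N 0%N, gC 2%N 0%N, gC 2%N 1%N, gC 3%N 0%N, gC 3%N 1%N,
  gC 3%N 2%N, gC 4%N 0%N, gC 4%N 1%N, gC 4%N 2%N, gC 4%N 3%N).
by lra.
Qed.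

Definition bdf5_energy : seq (seq R) := [seq [seq x / 1200 | x <- r] | r <-
  [:: [:: 1613; -2556; 1512; -504; 72];
     [:: -2556; 4505; -3024; 1068; -156];
     [:: 1512; -3024; 2501; -1008; 156];
     [:: -504; 1068; -1008; 465; -84];
     [:: 72; -156; 156; -84; 24]]].

Lemma bdf5_coef i : (i <= 5)%N -> (bdf_coef 5)`_i =
  [:: 137 / 60; -5; 5; -10 / 3; 5 / 4; -1 / 5]`_i.
Proof.
case: i => [|[|[|[|[|[|//]]]]]] _;
  rewrite coef_bdf_poly unlock /= !(binS, bin0, bin0n) /= ?(addnS, addn0); lra.
Qed.

Lemma bdf5_G_stable : G_stable 5 bdf5_energy.
Proof.
move=> g pg; have gC := pg.1; rewrite /qform /bdf5_energy; split.
  move: (psd_seq [:: 1000; -1588; 939; -313; 45] pg)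
    (psd_seq [:: 0; 1000; -1404; 603; -94] pg)
    (psd_seq [:: 0; 0; 1000; -779; 146] pg)
    (psd_seq [:: 0; 0; 0; 1000; -659] pg) (psd_diag 4 pg) (psd_diag 0 pg)
    (psd_diag 1 pg) (psd_diag 2 pg) (psd_diag 3 pg) (psd_pair 1 (-1) 0 1 pg)
    (psd_pair 1 1 0 2 pg) (psd_pair 1 (-1) 1 2 pg) (psd_pair 1 (-1) 0 3 pg)
    (psd_pair 1 1 1 3 pg) (psd_pair 1 (-1) 2 3 pg) (psd_pair 1 (-1) 0 4 pg)
    (psd_pair 1 1 1 4 pg) (psd_pair 1 (-1) 2 4 pg) (psd_pair 1 1 3 4 pg).
  rewrite unlock /= !(gC 1%N 0%N, gC 2%N 0%N, gC 2%N 1%N, gC 3%N 0%N, gC 3%N 1%N,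
    gC 3%N 2%N, gC 4%N 0%N, gC 4%N 1%N, gC 4%N 2%N, gC 4%N 3%N).
  by lra.
move: (psd_seq [:: 500; -744; 661; -665; 301; -53] pg)
  (psd_seq [:: 0; 500; -720; 837; -684; 67] pg)
  (psd_seq [:: 0; 0; 500; -515; -204; 219] pg)
  (psd_seq [:: 0; 0; 0; 250; -163; -87] pg) (psd_pair 1 (-1) 4 5 pg)
  (psd_pair 1 (-1) 0 1 pg) (psd_pair 1 (-1) 1 2 pg) (psd_pair 1 (-1) 2 3 pg)
  (psd_pair 1 (-1) 3 4 pg) (psd_seq [:: 1; -2; 1; 0; 0; 0] pg)
  (psd_seq [:: 1; -1; -1; 1; 0; 0] pg) (psd_seq [:: 0; 1; -2; 1; 0; 0] pg)
  (psd_seq [:: 1; -1; 0; -1; 1; 0] pg) (psd_seq [:: 0; 1; -1; 1; -1; 0] pg)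
  (psd_seq [:: 0; 0; 1; -2; 1; 0] pg) (psd_seq [:: 1; -1; 0; 0; 1; -1] pg)
  (psd_seq [:: 0; 1; -1; 0; -1; 1] pg) (psd_seq [:: 0; 0; 1; -1; 1; -1] pg)
  (psd_seq [:: 0; 0; 0; 1; -2; 1] pg).
rewrite unlock /= !bdf5_coef//=
  !(gC 1%N 0%N, gC 2%N 0%N, gC 2%N 1%N, gC 3%N 0%N, gC 3%N 1%N,
  gC 3%N 2%N, gC 4%N 0%N, gC 4%N 1%N, gC 4%N 2%N, gC 4%N 3%N, gC 5%N 0%N,
  gC 5%N 1%N, gC 5%N 2%N, gC 5%N 3%N, gC 5%N 4%N).
by lra.
Qed.

Lemma bdf_G_stable q : (1 <= q <= 5)%N -> exists G, G_stable q G.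
Proof.
case: q => [|[|[|[|[|[|//]]]]]] // _; eexists.
- exact: bdf1_G_stable.
- exact: bdf2_G_stable.
- exact: bdf3_G_stable.
- exact: bdf4_G_stable.
- exact: bdf5_G_stable.
Qed.

End bdf_energy.

(** * Stability of BDF schemes in terms of Gram arrays *)

Section bdf_gram_stability.
Context {R : realType}.
Local Notation bdf_coef q := (bdf_poly (R := R) q).

(** The leading coefficient is the harmonic number 1 + 1/2 + ... + 1/q. *)
Lemma bdf_coef0_ge1 q : (0 < q)%N -> 1 <= (bdf_coef q)`_0.
Proof.
move=> q0; rewrite coef_bdf_poly big_ltn// invr1 mul1r expr0 bin0 lerDl.
by apply: sumr_ge0 => m _; rewrite bin0 mulr1 invr_ge0.
Qed.

(* The arrays are (u^i, u^j), a(u^i, u^j) and j(p^i, p^j), and F bounds the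
   load; the first argument of phi is the time level of the equation. *)
Definition bdf_gram_scheme q N (tau : R) (H A J phi : nat -> nat -> R)
    (F : nat -> R) :=
  [/\ psd H, diag_dominated A, diag_dominated J,
      forall n m, (q <= n <= N)%N -> (q <= m <= N)%N ->
        tau^-1 * (\sum_(0 <= i < q.+1) (bdf_coef q)`_i * H (n - i)%N m)
          + A n m + J n m = phi n m &
      forall (e : R) n m, 0 < e -> (q <= n <= N)%N -> (q <= m <= N)%N ->
        0 <= F n /\ 2 * `|phi n m| <= F n / e + e * A m m].

(* Initial data enter through the L^2 norm only, so the first equation, which
   would involve a(u^q, u^(q-1)) and b(p^q, u^(q-1)) under the multiplier, is
   tested with u^q instead. *)
Lemma bdf_first_step q : (0 < q)%N -> exists2 K : R, 1 <= K &
  forall N (tau : R) H A J phi F, 0 < tau -> (q <= N)%N ->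
    bdf_gram_scheme q N tau H A J phi F ->
    H q q + tau * (A q q + J q q) <=
    K * (\sum_(0 <= i < q) H i i + tau * F q).
Proof.
move=> q0; pose D : R := \sum_(0 <= i < q.+1) `|(bdf_coef q)`_i|.
have D1 : 1 <= D.
  rewrite /D big_ltn// (le_trans (bdf_coef0_ge1 q0))//.
  by rewrite (le_trans (ler_norm _))// lerDl sumr_ge0.
have D0 : 0 < D by rewrite (lt_le_trans _ D1).
exists (1 + D ^+ 2) => [|N tau H A J phi F tau0 qN [pH pA pJ eqn young]].
  by rewrite lerDl sqr_ge0.
set S := \sum_(0 <= i < q) H i i.
have S0 : 0 <= S by apply: sumr_ge0 => i _; exact: psd_diag.
have qq : (q <= q <= N)%N by rewrite leqnn.
have [F0 phiF] := young 1 q q ltr01 qq qq.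
have Hq := psd_diag q pH.
have HS i : (i < q)%N -> H i i <= S by apply: term_le_sum => j; exact: psd_diag.
have := eqn q q qq qq; rewrite big_ltn// subn0.
set X := \sum_(1 <= i < q.+1) _ => e.
have XD : - (2 * X) <= H q q + D ^+ 2 * S.
  have -> : H q q + D ^+ 2 * S = D * (D^-1 * H q q + S / D^-1).
    by rewrite invrK; field; rewrite gt_eqF.
  rewrite /X mulr_sumr -sumrN.
  rewrite [leRHS](_ : _ = \sum_(0 <= i < q.+1)
     `|(bdf_coef q)`_i| * (D^-1 * H q q + S / D^-1)); last by rewrite -mulr_suml.
  (* The term i = 0 is absent from [X]; it was added on the right only to complete the sum D. *)
  rewrite [leRHS]big_ltn// -[leLHS]add0r lerD//.
    rewrite mulr_ge0// addr_ge0//; first by rewrite mulr_ge0// invr_ge0 ltW.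
    by rewrite divr_ge0// invr_ge0 ltW.
  apply: ler_sum_nat => i /andP[i0 iq].
  rewrite (le_trans (ler_norm _))// normrN mulrCA normrM ler_wpM2l//.
  rewrite normrM ger0_norm//.
  have iD0 : 0 < D^-1 by rewrite invr_gt0.
  have /le_trans := psd_young_weight (q - i)%N q pH iD0; apply.
  rewrite addrC lerD2l invrK ler_pM2r//.
  by apply: HS; rewrite ltn_subrL i0.
have {}e : (bdf_coef q)`_0 * H q q + X + tau * (A q q + J q q) = tau * phi q q.
  by rewrite -e; field; rewrite gt_eqF.
have Aq := (pA q q).1; have Jq := (pJ q q).1.
(* In the doubled identity the leading term yields 2 [H q q], one copy of which absorbs the loss in
   [XD]. *)
have d1 : H q q <= (bdf_coef q)`_0 * H q q by rewrite ler_peMl// bdf_coef0_ge1.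
have : tau * phi q q <= tau * ((F q + A q q) / 2).
  by rewrite ler_pM2l//; have := ler_norm (phi q q); lra.
have := mulr_ge0 (ltW tau0) F0; have := mulr_ge0 (ltW tau0) Aq.
have := mulr_ge0 (ltW tau0) Jq.
have := mulr_ge0 (sqr_ge0 D) (mulr_ge0 (ltW tau0) F0).
by rewrite !mulrDr !mulrDl !mul1r; lra.
Qed.

(** Young's inequality for consecutive levels leaves at most tau/2 of the diagonal terms at the
    previous level. The energy [E] carries that amount along, and the surplus 21/40 - 1/2 = 1/40 at
    the current level is the dissipation that remains. *)
Lemma bdf_energy_decay q G N (tau : R) H A J phi F : (0 < q)%N -> G_stable q G ->
    0 < tau -> bdf_gram_scheme q N tau H A J phi F ->
  let E n := qform q G (fun i j => H (n - i)%N (n - j)%N)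
               + tau / 2 * (A n n + J n n) in
  forall M, (q <= M <= N)%N ->
    E M + tau / 40 * \sum_(q.+1 <= n < M.+1) (A n n + J n n) <=
    E q + 19 * tau * \sum_(q.+1 <= n < M.+1) F n.
Proof.
move=> q0 GG tau0 [pH pA pJ eqn young] E M /andP[]; rewrite leq_eqVlt.
elim: M => [|M IH]; first by case: (q) q0.
move=> /orP[/eqP<- _|qM MN]; first by rewrite !big_geq// !mulr0.
have {}IH := IH (_ : _ || _) (ltnW MN); move: IH; rewrite -leq_eqVlt => /(_ qM) IH.
rewrite ltnS in qM.
rewrite big_nat_recr//= [in leRHS]big_nat_recr//=.
have qM1 : (q <= M.+1 <= N)%N by rewrite MN andbT leqW.
have qM0 : (q <= M <= N)%N by rewrite (ltnW MN) andbT.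
(* The array of the window ending at [M.+1], shifted by one, is the array of the window ending at
   [M]. *)
have [_ diss] := GG _ (psd_reindex (fun i => (M.+1 - i)%N) pH).
(* With weight 1/20 the loads tested with u^n and 9/10 u^(n-1) cost 10 F + 9 F = 19 F, plus 1/40 of
   [A] at the current level and 9/400 at the previous one. *)
have e20 : 0 < 20^-1 :> R by rewrite invr_gt0.
have [F0 phi0] := young _ _ _ e20 qM1 qM1.
have [_ phi1] := young _ _ _ e20 qM1 qM0.
have A1 := (pA M.+1 M).2; have J1 := (pJ M.+1 M).2.
have J0 := (pJ M M).1; have J00 := (pJ M.+1 M).1.
have A0 := (pA M M).1; have A00 := (pA M.+1 M).1.
have {}diss : qform q G (fun i j => H (M.+1 - i)%N (M.+1 - j)%N)
    - qform q G (fun i j => H (M - i)%N (M - j)%N) <=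
    tau * (phi M.+1 M.+1 - A M.+1 M.+1 - J M.+1 M.+1
          - 9 / 10 * (phi M.+1 M - A M.+1 M - J M.+1 M)).
  apply: (le_trans diss); rewrite -!eqn// le_eqVlt; apply/orP; left; apply/eqP.
  rewrite !subn0 subn1/=.
  under eq_bigr do rewrite mulrBr mulrCA.
  by rewrite sumrB -mulr_sumr; field; rewrite gt_eqF.
have := ler_norm (phi M.+1 M.+1); have := ler_norm (- phi M.+1 M).
rewrite normrN => p1 p2.
have {}A1 := le_trans (ler_norm _) A1;
have {}J1 := le_trans (ler_norm _) J1.
(* At the current level 1 - 9/20 - 1/40 = 21/40 of [A] survives; at the previous level 9/20 + 9/400
   is below 1/2. The bounds for [J] have room to spare. *)
have {}diss : qform q G (fun i j => H (M.+1 - i)%N (M.+1 - j)%N)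
    - qform q G (fun i j => H (M - i)%N (M - j)%N) <=
    tau * (19 * F M.+1 - 21 / 40 * (A M.+1 M.+1 + J M.+1 M.+1)
          + 1 / 2 * (A M M + J M M)).
  by apply: (le_trans diss); rewrite ler_pM2l//; lra.
move: IH diss; rewrite /E !(mulrDr, mulrBr); lra.
Qed.

Lemma bdf_gram_stability q : (1 <= q <= 5)%N -> exists2 C : R, 0 < C &
  forall N (tau : R) H A J phi F, 0 < tau -> (q <= N)%N ->
    bdf_gram_scheme q N tau H A J phi F ->
    H N N + tau * \sum_(q <= n < N.+1) A n n
      + tau * \sum_(q <= n < N.+1) J n n <=
    C * (\sum_(0 <= i < q) H i i + tau * \sum_(q <= n < N.+1) F n).
Proof.
move=> q15; have q0 : (0 < q)%N by case/andP: q15.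
have [G GG] := bdf_G_stable (R := R) q15.
have [K K1 first] := bdf_first_step q0.
have [L L0 GL] := qform_le q G.
have K0 : 0 < K by rewrite (lt_le_trans _ K1).
(* The bracket bounds the right side of the decay estimate. Recovering [H N N] costs 1000, the lower
   bound in [G_stable], and recovering the dissipation costs 40; the last [K] pays for level q. *)
exists (1040 * (L * q%:R * (K + 1) + K + 19) + K).
  have : 0 <= L * q%:R * (K + 1) by rewrite !mulr_ge0// ?addr_ge0// ltW.
  by lra.
move=> N tau H A J phi F tau0 qN sch.
have {}first := first _ _ _ _ _ _ _ tau0 qN sch.
have /= decay := bdf_energy_decay q0 GG tau0 sch.
have [pH pA pJ eqn young] := sch.
have {}decay := decay N; rewrite qN leqnn in decay; have {}decay := decay isT.
have tau_ge0 := ltW tau0.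
have GN := (GG _ (psd_reindex (fun i => (N - i)%N) pH)).1.
have Gq := GL _ (psd_reindex (fun i => (q - i)%N) pH).
rewrite -addrA -mulrDr -big_split/= ![\sum_(q <= n < N.+1) _]big_ltn ?ltnS//.
set S := \sum_(0 <= i < q) H i i in first *.
set X := \sum_(q.+1 <= n < N.+1) _ in decay *.
set Y := \sum_(q.+1 <= n < N.+1) _ in decay *.
have Hq := psd_diag q pH.
have S0 : 0 <= S by apply: sumr_ge0 => i _; exact: psd_diag.
have HS i : (i < q)%N -> H i i <= S by apply: term_le_sum => j; exact: psd_diag.
have X0 : 0 <= X.
  by apply: sumr_ge0 => n _; rewrite addr_ge0//; case: (pA n n); case: (pJ n n).
(* Nonnegativity of [F] is known only at levels between q and N. *)
have Y0 : 0 <= Y.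
  rewrite /Y big_nat_cond; apply: sumr_ge0 => n /andP[/andP[qn nN] _].
  have nn : (q <= n <= N)%N by rewrite ltnW.
  by have [] := young 1 n n ltr01 nn nn.
have F0 : 0 <= F q.
  have qq : (q <= q <= N)%N by rewrite leqnn.
  by have [] := young 1 q q ltr01 qq qq.
set Z := S + tau * (F q + Y).
have SZ : S + tau * F q <= Z by rewrite lerD2l ler_pM2l// lerDl.
have P0 : 0 <= tau * (A q q + J q q)
  by rewrite mulr_ge0// addr_ge0// ?(pA _ 0%N).1 ?(pJ _ 0%N).1.
have {SZ} KZ : K * (S + tau * F q) <= K * Z by rewrite ler_pM2l.
have Sz : S <= Z by rewrite lerDl mulr_ge0// ?addr_ge0//.
(* The window consists of the levels q, ..., 1: the first step bounds level q, and the initial data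
   bound the others. *)
have {}Gq : qform q G (fun i j => H (q - i)%N (q - j)%N) <=
    L * q%:R * (K + 1) * Z.
  apply: (le_trans Gq); rewrite -!mulrA ler_pM2l//.
  apply: (@le_trans _ _ (\sum_(0 <= i < q) (K + 1) * Z)).
    apply: ler_sum_nat => i /andP[_ iq]; case: i iq => [_|i iq].
      by rewrite subn0 mulrDl mul1r; lra.
    rewrite (le_trans (HS _ _))//; first by rewrite ltn_subrL.
    by rewrite mulrDl mul1r; lra.
  by rewrite sumr_const_nat subn0 mulr_natl.
have Yz : tau * Y <= Z.
  by rewrite -[leLHS]add0r lerD// ler_pM2l// lerDr.
have tX0 : 0 <= tau * X by rewrite mulr_ge0//.
have tN0 : 0 <= tau * (A N N + J N N)
  by rewrite mulr_ge0// addr_ge0// ?(pA _ 0%N).1 ?(pJ _ 0%N).1.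
rewrite /= subn0 in GN.
move: GN Gq decay first KZ Yz tX0 P0 tN0.
set a := qform _ _ _; set b := qform _ _ _.
by have := psd_diag N pH; lra.
Qed.

End bdf_gram_stability.

(** * Gram arrays of symmetric forms that are bilinear on a subspace *)

Section gram_arrays.
Context {R : realType} {V : lmodType R} (D : V -> Prop) (B : V -> V -> R).
Hypothesis D0 : D 0.
Hypothesis D_lin : forall (c : R) x y, D x -> D y -> D (c *: x + y).
Hypothesis B_lin : forall (c : R) x y z, D x -> D y -> D z ->
  B (c *: x + y) z = c * B x z + B y z.
Hypothesis B_sym : forall x y, B x y = B y x.
Hypothesis B_ge0 : forall x, 0 <= B x x.

(** Membership and expansion are proved in one induction, because [B] is linear only on [D]. *)
Lemma gram_suml n (c : nat -> R) (x : nat -> V) : (forall i, D (x i)) ->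
  D (\sum_(0 <= i < n) c i *: x i) /\
  forall y, D y ->
    B (\sum_(0 <= i < n) c i *: x i) y = \sum_(0 <= i < n) c i * B (x i) y.
Proof.
move=> Dx; elim: n => [|n [Dn IH]].
  split=> [|y Dy]; rewrite !big_geq//.
  (* Linearity at [1 *: 0 + 0] gives [B 0 y = B 0 y + B 0 y]. *)
  by have := B_lin 1 D0 D0 Dy; rewrite scaler0 addr0 mul1r; lra.
rewrite big_nat_recr//= addrC; split=> [|y Dy]; first exact: D_lin.
by rewrite B_lin// IH// [RHS]big_nat_recr//= addrC.
Qed.

(** The double sum is [B s s] for the linear combination s of the selected vectors. *)
Lemma gram_psd (x : nat -> V) : (forall i, D (x i)) ->
  psd (fun i j => B (x i) (x j)).
Proof.
move=> Dx; split=> [i j|n c k]; first exact: B_sym.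
have Dk i : D ((x \o k) i) by exact: Dx.
have [Dn suml] := gram_suml n c Dk.
apply: (le_trans (B_ge0 (\sum_(0 <= i < n) c i *: x (k i)))).
rewrite suml// le_eqVlt; apply/orP; left; apply/eqP; apply: eq_bigr => i _.
rewrite B_sym suml// mulr_sumr; apply: eq_bigr => j _.
by rewrite mulrA B_sym.
Qed.

End gram_arrays.

(** * The L^2 inner product on scalar and matrix fields *)

Section L2_forms.
Context {R : realType} {d : nat} (Omega : set 'rV[R]_d).
Hypothesis mOmega : measurable Omega.
Local Notation mu := (@lebesgue_rV R d).
Implicit Types f g h : 'rV[R]_d -> R.

(** The product is dominated by f^2 + g^2. *)
Lemma L2_ip_integrable f g : L2 Omega f -> L2 Omega g ->
  mu.-integrable Omega (EFin \o (fun x => f x * g x)).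
Proof.
move=> [mf If] [mg Ig].
apply: (le_integrable mOmega _ _ (integrableD mOmega If Ig)).
  by apply/measurable_EFinP; exact: measurable_funM.
move=> x _; rewrite /= lee_fin normrM.
rewrite [leRHS]ger0_norm ?addr_ge0 ?sqr_ge0//.
rewrite -(real_normK (num_real (f x))) -(real_normK (num_real (g x))).
by have := sqr_ge0 (`|f x| - `|g x|); have := normr_ge0 (f x);
  have := normr_ge0 (g x); nra.
Qed.

Lemma L2_lin (c : R) f g : L2 Omega f -> L2 Omega g -> L2 Omega (c *: f + g).
Proof.
move=> Lf Lg; have [[mf If] [mg Ig]] := (Lf, Lg).
split; first by apply: measurable_funD => //; exact: measurable_funM.
(* The square of c f + g is expanded into three integrable terms. *)
apply: eq_integrable (integrableD mOmega (integrableD mOmega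
  (integrableZl mOmega (c ^+ 2) If)
  (integrableZl mOmega (2 * c) (L2_ip_integrable Lf Lg))) Ig) => //.
move=> x _; rewrite /= -!EFinM -!EFinD; congr EFin.
by rewrite !fctE -[c *: f x]/(c * f x); ring.
Qed.

Lemma L2_0 : L2 Omega 0.
Proof.
split; first exact: measurable_cst.
apply: eq_integrable (integrable0 mu Omega) => // x _ /=.
by rewrite expr0n.
Qed.

Lemma ip_linl (c : R) f g h : L2 Omega f -> L2 Omega g -> L2 Omega h ->
  ip Omega (c *: f + g) h = c * ip Omega f h + ip Omega g h.
Proof.
move=> Lf Lg Lh; rewrite /ip -RintegralZl//; last exact: L2_ip_integrable.
rewrite -RintegralD//; last 2 first.
- exact: (integrableZl mOmega c (L2_ip_integrable Lf Lh)).
- exact: L2_ip_integrable.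
by apply: eq_Rintegral => x _; rewrite mulrDl -mulrA.
Qed.

Lemma ipC f g : ip Omega f g = ip Omega g f.
Proof. by apply: eq_Rintegral => x _; rewrite mulrC. Qed.

Lemma ip_ge0 f : 0 <= ip Omega f f.
Proof. by apply: Rintegral_ge0 => x _; rewrite -expr2 sqr_ge0. Qed.

Section matrix_fields.
Context {m n : nat}.
Implicit Types F G K : 'rV[R]_d -> 'M[R]_(m, n).

Lemma L2mx_lin (c : R) F G : L2mx Omega F -> L2mx Omega G -> L2mx Omega (c *: F + G).
Proof.
move=> LF LG i j; have := L2_lin c (LF i j) (LG i j).
by congr L2; apply/funext => x; rewrite !mxE.
Qed.

Lemma L2mx0 : L2mx Omega (0 : 'rV[R]_d -> 'M[R]_(m, n)).
Proof.
by move=> i j; have := L2_0; congr L2; apply/funext => x; rewrite mxE.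
Qed.

Lemma ipmx_linl (c : R) F G K : L2mx Omega F -> L2mx Omega G -> L2mx Omega K ->
  ipmx Omega (c *: F + G) K = c * ipmx Omega F K + ipmx Omega G K.
Proof.
move=> LF LG LK; rewrite /ipmx mulr_sumr -big_split/=; apply: eq_bigr => i _.
rewrite mulr_sumr -big_split/=; apply: eq_bigr => j _.
rewrite -ip_linl//; congr (ip _ _ _); apply/funext => x.
by rewrite !mxE.
Qed.

Lemma ipmxZl (c : R) F K : L2mx Omega F -> L2mx Omega K ->
  ipmx Omega (c *: F) K = c * ipmx Omega F K.
Proof.
move=> LF LK; have := ipmx_linl (c - 1) LF LF LK.
by rewrite scalerBl scale1r subrK => ->; ring.
Qed.

Lemma ipmxC F G : ipmx Omega F G = ipmx Omega G F.
Proof. by apply: eq_bigr => i _; apply: eq_bigr => j _; exact: ipC. Qed.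

Lemma ipmx_ge0 F : 0 <= ipmx Omega F F.
Proof. by apply: sumr_ge0 => i _; apply: sumr_ge0 => j _; exact: ip_ge0. Qed.

Lemma ipmx_psd (F : nat -> 'rV[R]_d -> 'M[R]_(m, n)) :
  (forall i, L2mx Omega (F i)) -> psd (fun i j => ipmx Omega (F i) (F j)).
Proof.
exact: (gram_psd L2mx0 L2mx_lin ipmx_linl ipmxC ipmx_ge0).
Qed.

End matrix_fields.

Lemma ipmx_bdf q (tau : R) (w : nat -> 'rV[R]_d -> 'rV[R]_d) n v :
    (forall i, L2mx Omega (w i)) -> L2mx Omega v ->
  ipmx Omega (bdf q tau w n) v =
  tau^-1 * \sum_(0 <= i < q.+1) (bdf_poly q)`_i * ipmx Omega (w (n - i)%N) v.
Proof.
move=> Lw Lv; have Lwn i : L2mx Omega (w (n - i)%N) by exact: Lw.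
rewrite /bdf -(big_mkord xpredT (fun i => (bdf_poly q)`_i *: w (n - i)%N)).
rewrite scaler_sumr; under eq_bigr do rewrite scalerA.
rewrite (gram_suml L2mx0 L2mx_lin ipmx_linl _
  (fun i => tau^-1 * (bdf_poly q)`_i) Lwn).2//.
by rewrite mulr_sumr; apply: eq_bigr => i _; rewrite mulrA.
Qed.

End L2_forms.

(** * From the discrete Stokes equations to Gram arrays *)

Section stokes_scheme.
Context {R : realType} {d : nat} (Omega : set 'rV[R]_d) (nu cP : R).
Hypothesis mOmega : measurable Omega.
Hypothesis nu_gt0 : 0 < nu.
Hypothesis cP_poincare : poincare_constant Omega nu cP.

Lemma a_formE (v w : vfield R d) : L2mx Omega v.2 -> L2mx Omega w.2 ->
  a_form Omega nu v w = nu * ipmx Omega v.2 w.2.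
Proof. by move=> Lv Lw; rewrite /a_form ipmxZl. Qed.

Lemma a_form_ge0 v : L2mx Omega v.2 -> 0 <= a_form Omega nu v v.
Proof. by move=> Lv; rewrite a_formE// mulr_ge0 ?ipmx_ge0// ltW. Qed.

Lemma sqr_normV v : L2mx Omega v.2 -> normV Omega nu v ^+ 2 = a_form Omega nu v v.
Proof. by move=> Lv; rewrite sqr_sqrtr// a_form_ge0. Qed.

Lemma sqr_normH (v : 'rV[R]_d -> 'rV[R]_d) : normH Omega v ^+ 2 = ipmx Omega v v.
Proof. by rewrite sqr_sqrtr// ipmx_ge0. Qed.

Lemma a_form_diag_dominated (v : nat -> vfield R d) :
    (forall i, L2mx Omega (v i).2) ->
  diag_dominated (fun i j => a_form Omega nu (v i) (v j)).
Proof.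
move=> Lv i j; rewrite a_form_ge0//; split=> //.
have := psd_young i j (ipmx_psd mOmega Lv); rewrite !a_formE// normrM.
rewrite gtr0_norm// -mulrDr -mulrA ler_pM2l//.
Qed.

(** Young's inequality with weight e nu / cP^2, which the Poincaré inequality turns into the weight
    e on a(v, v). *)
Lemma poincare_young (e : R) (f : 'rV[R]_d -> 'rV[R]_d) (v : vfield R d) :
    0 < e -> L2mx Omega f -> H10 Omega v ->
  2 * `|ipmx Omega f v.1| <=
  cP ^+ 2 / nu * normH Omega f ^+ 2 / e + e * a_form Omega nu v v.
Proof.
move=> e0 Lf Hv; have [Lv1 Lv2 _] := Hv.
have [cP0 /(_ v Hv) poin] := cP_poincare.
have s0 : 0 < e * nu / cP ^+ 2 by rewrite divr_gt0 ?exprn_gt0// mulr_gt0.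
(* A sequence with the two values [f] and [v.1], so that their inner product is an entry of a Gram
   array. *)
pose x i : 'rV[R]_d -> 'rV[R]_d := if i is 0%N then f else v.1.
have Lx i : L2mx Omega (x i) by case: i.
have := psd_young_weight 0%N 1%N (ipmx_psd mOmega Lx) s0; rewrite /x.
move=> /le_trans; apply; rewrite -!sqr_normH -sqr_normV//; apply: lerD.
  by rewrite le_eqVlt; apply/orP; left; apply/eqP; field; rewrite !gt_eqF.
have poin2 : normH Omega v.1 ^+ 2 <= cP ^+ 2 / nu * normV Omega nu v ^+ 2.
  have -> : cP ^+ 2 / nu = (cP * (Num.sqrt nu)^-1) ^+ 2.
    by rewrite exprMn exprVn sqr_sqrtr// ltW.
  rewrite -exprMn lerXn2r// nnegrE ?sqrtr_ge0//.
  by rewrite !mulr_ge0// ?invr_ge0 ?sqrtr_ge0// ltW.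
have -> : e * normV Omega nu v ^+ 2 =
    e * nu / cP ^+ 2 * (cP ^+ 2 / nu * normV Omega nu v ^+ 2).
  by field; rewrite !gt_eqF.
by rewrite ler_pM2l.
Qed.

(* The clipped sequences u' and p' agree with u and p where those are
   controlled and make the Gram arrays total. *)
Lemma bdf_solution_gram (Vh : vfield R d -> Prop) (Qh : ('rV[R]_d -> R) -> Prop)
    (j : ('rV[R]_d -> R) -> ('rV[R]_d -> R) -> R) q N tau f u p :
    (forall v, Vh v -> H10 Omega v) ->
    (forall r, Qh r -> 0 <= j r r) ->
    (forall r s, Qh r -> Qh s ->
      `|j r s| <= Num.sqrt (j r r) * Num.sqrt (j s s)) ->
    (q <= N)%N ->
    (forall n, (n <= N)%N -> L2mx Omega (f (n%:R * tau))) ->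
    bdf_solution Omega nu Vh Qh j q N tau f u p ->
  let u' n := u (minn n N) in
  let p' n := p (maxn q (minn n N)) in
  bdf_gram_scheme q N tau (fun n m => ipmx Omega (u' n).1 (u' m).1)
    (fun n m => a_form Omega nu (u' n) (u' m)) (fun n m => j (p' n) (p' m))
    (fun n m => ipmx Omega (f (n%:R * tau)) (u' m).1)
    (fun n => cP ^+ 2 / nu * normH Omega (f (n%:R * tau)) ^+ 2).
Proof.
move=> VH j0 jCS qN Lf [Vu0 sol] u' p'.
have Vu n : Vh (u' n).
  rewrite /u'; have [nq|qn] := ltnP (minn n N) q; first exact: Vu0.
  by have [] := sol (minn n N); rewrite ?qn ?geq_minr.
have Qp n : Qh (p' n).
  by have [] := sol (maxn q (minn n N)); rewrite ?leq_maxl ?geq_max ?qN ?geq_minr.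
have Hu n := VH _ (Vu n).
have u'E n : (n <= N)%N -> u' n = u n by move=> nN; rewrite /u' (minn_idPl nN).
have p'E n : (q <= n <= N)%N -> p' n = p n.
  by move=> /andP[qn nN]; rewrite /p' (minn_idPl nN) (maxn_idPr qn).
split.
- by apply: (ipmx_psd mOmega (F := fun n => (u' n).1)) => n; case: (Hu n).
- by apply: a_form_diag_dominated => n; case: (Hu n).
- move=> n m; split; first exact: j0.
  apply: (le_trans (jCS _ _ (Qp n) (Qp m))).
  have := sqr_ge0 (Num.sqrt (j (p' n) (p' n)) - Num.sqrt (j (p' m) (p' m))).
  rewrite sqrrB !sqr_sqrtr ?j0//; set s := _ * _; lra.
- move=> n m qnN qmN; have /andP[qn nN] := qnN; have /andP[qm mN] := qmN.
  have [_ _ /(_ _ (Vu m)) eqn _] := sol n qnN.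
  have [_ _ _ /(_ _ (Qp n)) inc] := sol m qmN.
  (* The incompressibility equation at level [m], available since [m] is at least q, is tested with
     the pressure of level [n]. *)
  have -> : j (p' n) (p' m) = b_form Omega (p n) (u m).
    by move: inc; rewrite !p'E//; lra.
  rewrite !u'E// in eqn *; rewrite -eqn; congr (_ + _ + _).
  have -> : bdf q tau (fun i => (u i).1) n = bdf q tau (fun i => (u' i).1) n.
    congr (_ *: _); apply: eq_bigr => i _.
    by rewrite u'E// (leq_trans (leq_subr _ _)).
  rewrite ipmx_bdf//; last by rewrite -u'E//; case: (Hu m).
  by move=> i; case: (Hu i).
- move=> e n m e0 /andP[qn nN] _; split.
    by rewrite mulr_ge0 ?sqr_ge0// divr_ge0 ?sqr_ge0// ltW.
  exact: poincare_young (Lf n nN) (Hu m).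
Qed.

End stokes_scheme.

(** * Stability of the fully discrete solution *)

Unset Implicit Arguments.

Theorem theorem4p1 (R : realType) (d : nat) (Omega : set 'rV[R]_d) (nu cP : R)
    (k l lbar : nat) (cont : bool) (Th : R -> seq 'M[R]_(d.+1, d))
    (jh : R -> ('rV[R]_d -> R) -> ('rV[R]_d -> R) -> R)
    (Ip : R -> ('rV[R]_d -> R) -> 'rV[R]_d -> R)
    (Iu : R -> vfield R d -> vfield R d) (q : nat)
    (Vh := fun h => Vspace Omega k (Th h))
    (Qh := fun h => Qspace Omega cont l (Th h)) :
  d = 2%N \/ d = 3%N ->
  lipschitz_domain Omega ->
  0 < nu ->
  poincare_constant Omega nu cP ->
  (0 < k)%N -> (k.-1 <= l <= k)%N -> (0 < lbar)%N ->
  quasi_uniform Omega Th ->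
  pressure_stabilization Omega nu Qh jh ->
  interpolation Omega nu Vh Qh jh k l lbar Ip Iu ->
  (1 <= q <= 5)%N ->
  exists C : R, 0 < C /\
    forall (h tau T : R) (N : nat) (f : R -> 'rV[R]_d -> 'rV[R]_d)
      (u : nat -> vfield R d) (p : nat -> 'rV[R]_d -> R),
    0 < h <= 1 -> 0 < T -> 0 < tau -> N%:R * tau <= T ->
    continuous_L2 Omega T f ->
    bdf_solution Omega nu (Vh h) (Qh h) (jh h) q N tau f u p ->
    normH Omega (u N).1 ^+ 2
      + l2norm (normV Omega nu) q N tau u ^+ 2
      + l2norm (normj jh h) q N tau p ^+ 2
    <= C * (\sum_(i < q) normH Omega (u i).1 ^+ 2
            + cP ^+ 2 / nu
              * l2norm (normH Omega) q N tau (fun n => f (n%:R * tau)) ^+ 2).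
Proof.
move=> _ [_ oOmega _ _ _] nu0 cP_poincare _ _ _ _ [jP [Cj [_ jCS]]] _ q15.
have mOmega : measurable Omega := open_measurable_rV oOmega.
have [C C0 stable] := bdf_gram_stability (R := R) q15.
(* The summand 1 covers the case N < q. *)
exists (C + 1); split; first by rewrite addr_gt0.
move=> h tau T N f u p h01 T0 tau0 NT Lf sol.
have [_ _ j_ge0] := jP h h01.
have sqr_l2norm (W : Type) (norm : W -> R) (w : nat -> W) :
    l2norm norm q N tau w ^+ 2 = tau * \sum_(q <= n < N.+1) norm (w n) ^+ 2.
  rewrite sqr_sqrtr//; apply: mulr_ge0; first exact: ltW.
  by apply: sumr_ge0 => n _; exact: sqr_ge0.
rewrite !sqr_l2norm -(big_mkord xpredT (fun i => normH Omega (u i).1 ^+ 2)).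
set S := \sum_(0 <= i < q) _; set F := cP ^+ 2 / nu * _.
have F0 : 0 <= F.
  apply: mulr_ge0; first by rewrite divr_ge0 ?sqr_ge0 ?ltW.
  by apply: mulr_ge0; [exact: ltW|apply: sumr_ge0 => n _; exact: sqr_ge0].
have S0 : 0 <= S by apply: sumr_ge0 => i _; exact: sqr_ge0.
(* For N < q the time sums are empty and u^N is itself an initial value. *)
have [Nq|qN] := ltnP N q.
  rewrite ![\sum_(q <= n < N.+1) _]big_geq// mulr0 !addr0.
  apply: (@le_trans _ _ S).
    by apply: (term_le_sum (fun i => sqr_ge0 (normH Omega (u i).1))).
  by rewrite mulrDl mul1r; have := mulr_ge0 (ltW C0) (addr_ge0 S0 F0); lra.
(* The load is in L^2 at time n tau because n tau <= N tau <= T. *)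
have Lfn n : (n <= N)%N -> L2mx Omega (f (n%:R * tau)).
  move=> nN; have [] := Lf (n%:R * tau); last by [].
  rewrite mulr_ge0 ?(ltW tau0)//=.
  by apply: le_trans NT; rewrite ler_pM2r// ler_nat.
have gram := bdf_solution_gram mOmega nu0 cP_poincare (fun v (Hv : Vh h v) => Hv.1)
  j_ge0 (fun r s Qr Qs => (jCS h h01 r s Qr Qs).1) qN Lfn sol.
apply: (@le_trans _ _ (C * (S + F))); last first.
  by rewrite ler_wpM2r ?addr_ge0// lerDl.
have := stable _ _ _ _ _ _ _ tau0 qN gram.
rewrite -mulr_sumr mulrCA minnn -!sqr_normH /S.
(* On the ranges of the sums the clipped indices are the original ones, so the Gram diagonals are
   the squared norms. *)
have -> : \sum_(0 <= i < q) ipmx Omega (u (minn i N)).1 (u (minn i N)).1 = S.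
  apply: eq_big_nat => i /andP[_ iq].
  by rewrite (minn_idPl _) ?sqr_normH// (leq_trans (ltnW iq)).
have -> : \sum_(q <= n < N.+1) a_form Omega nu (u (minn n N)) (u (minn n N)) =
    \sum_(q <= n < N.+1) normV Omega nu (u n) ^+ 2.
  apply: eq_big_nat => n; rewrite ltnS => qnN; have [qn nN] := andP qnN.
  have [[[_ Lu _] _] _ _ _] := sol.2 n qnN.
  by rewrite (minn_idPl nN) sqr_normV.
have -> // : \sum_(q <= n < N.+1)
      jh h (p (maxn q (minn n N))) (p (maxn q (minn n N))) =
    \sum_(q <= n < N.+1) normj jh h (p n) ^+ 2.
apply: eq_big_nat => n; rewrite ltnS => qnN; have [qn nN] := andP qnN.
have [_ Qp _ _] := sol.2 n qnN.
by rewrite (minn_idPl nN) (maxn_idPr qn) sqr_sqrtr// j_ge0.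
Qed.
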